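(* Let $g$ satisfy (G1) and (G2), and let $\beta:=\max_{\pi\in[0,1]}|(\mathcal{A}g)(\pi)|$. For any $\epsilon>0$ there exist a sufficiently large $K_0=K_0(\epsilon)>\beta^{-1}$ and a constant $C=C(K_0,\epsilon)>0$ such that $$A^*(K)\le\frac{1}{1+CK^{1-\epsilon}},\qquad B^*(K)\ge\frac{CK^{1-\epsilon}}{1+CK^{1-\epsilon}},\qquad\forall K\ge K_0.$$
   Context: For $f\in C^2(0,1)$, $(\mathcal{A}f)(\pi):=\tfrac12\pi^2(1-\pi)^2f''(\pi)$. The function $g:[0,1]\to\mathbb{R}$ satisfies: (G1) $g\in C^2(0,1)$ is concave and $g(0)=g(1)=0$; (G2) there exists $\pi_0\in(0,1)$ such that $\mathcal{A}g$ is strictly decreasing on $(0,\pi_0)$ and strictly increasing on $(\pi_0,1)$. The limits of $\mathcal{A}g$ at $0$ and $1$ are $0$, so $\mathcal{A}g$ is extended by $0$ to $\{0,1\}$, and $\beta=|(\mathcal{A}g)(\pi_0)|>0$. The function $g$ is fixed and $K$ is a positive parameter. For $\pi\in(0,1)$, $\Psi(\pi):=(1-2\pi)\log\left(\frac{\pi}{1-\pi}\right)$ and $H(\pi;K):=g(\pi)-2K^{-1}\Psi(\pi)$; $H'$ denotes the derivative in $\pi$. For $K>\beta^{-1}$ the set $\{\pi\in(0,1):(\mathcal{A}g)(\pi)<-K^{-1}\}$ is a nonempty open interval with endpoints $0<\pi_*(K)<\pi^*(K)<1$, and $(A^*(K),B^*(K))$ denotes the unique pair $(A,B)\in(0,1)^2$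 with $A\le\pi_*(K)$, $B\ge\pi^*(K)$, satisfying $H(B;K)-H(A;K)=H'(A;K)(B-A)$ and $H'(A;K)=H'(B;K)$. *)

(* Defs.v *)
(* Stdlib reals with Coquelicot. *)
From Stdlib Require Import Reals.
From Coquelicot Require Import Coquelicot.
Open Scope R_scope.

(* The functions on [0,1] are represented by total functions R -> R, of which
   only the values on [0,1] are ever used. *)

Definition C2_on_unit (f : R -> R) : Prop :=
  forall x, 0 < x < 1 ->
    ex_derive f x /\ ex_derive (Derive f) x /\ continuous (Derive_n f 2) x.

Definition concave_on_unit (f : R -> R) : Prop :=
  forall x y t, 0 <= x <= 1 -> 0 <= y <= 1 -> 0 <= t <= 1 ->
    t * f x + (1 - t) * f y <= f (t * x + (1 - t) * y).

Definition strictly_decreasing_on (a b : R) (f : R -> R) : Prop :=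
  forall x y, a < x -> x < y -> y < b -> f y < f x.

Definition strictly_increasing_on (a b : R) (f : R -> R) : Prop :=
  forall x y, a < x -> x < y -> y < b -> f x < f y.

(* Derive_n is total, so the factor p^2 (1-p)^2 makes this formula vanish at
   p = 0 and p = 1: it is already the extension of (A f) by 0 to {0,1}. *)
Definition genA (f : R -> R) (p : R) : R :=
  / 2 * p ^ 2 * (1 - p) ^ 2 * Derive_n f 2 p.

Definition G1 (g : R -> R) : Prop :=
  C2_on_unit g /\ concave_on_unit g /\ g 0 = 0 /\ g 1 = 0.

Definition G2 (g : R -> R) : Prop :=
  exists p0, 0 < p0 < 1 /\
    strictly_decreasing_on 0 p0 (genA g) /\
    strictly_increasing_on p0 1 (genA g).

Definition is_max_on_unit (f : R -> R) (m : R) : Prop :=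
  (exists p, 0 <= p <= 1 /\ f p = m) /\
  (forall p, 0 <= p <= 1 -> f p <= m).

Definition Psi (p : R) : R := (1 - 2 * p) * ln (p / (1 - p)).

Definition Hfun (g : R -> R) (K p : R) : R := g p - 2 * / K * Psi p.

(* lo = pi_*(K) and hi = pi^*(K): the endpoints of the nonempty open interval
   {p in (0,1) : (A g)(p) < - 1/K}. *)
Definition is_sublevel_endpoints (g : R -> R) (K lo hi : R) : Prop :=
  0 < lo /\ lo < hi /\ hi < 1 /\
  (forall p, 0 < p < 1 -> (genA g p < - / K <-> lo < p < hi)).

(* (A,B) = (A^*(K), B^*(K)). *)
Definition is_boundary_pair (g : R -> R) (K A B : R) : Prop :=
  0 < A < 1 /\ 0 < B < 1 /\
  (exists lo hi, is_sublevel_endpoints g K lo hi /\ A <= lo /\ hi <= B) /\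
  Hfun g K B - Hfun g K A = Derive (Hfun g K) A * (B - A) /\
  Derive (Hfun g K) A = Derive (Hfun g K) B.

(* Main.v *)
(* Since (A Psi) = -1/2, the function H is convex outside the sublevel interval
   and concave inside it, so the bitangent line through A and B lies below H
   everywhere on [A,B].  At the single point 1/2, where Psi vanishes, this says
   that the tangent line of H at p = A or p = B has height at most g(1/2)
   there.  The tangent lines of the strictly concave g overshoot g(1/2) by some
   c > 0, uniformly for p near 0 or 1; hence (2/K) Psi'(p) (1/2 - p) >= c.  As
   Psi'(p) (1/2 - p) is of the order of 1/p near 0 and 1/(1-p) near 1, the
   distances of A to 0 and of B to 1 are O(1/K), which is even stronger than
   O(K^(eps-1)). *)
Require Import Defs.
From Stdlib Require Import Reals Lra.
From Coquelicot Require Import Coquelicot.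
Open Scope R_scope.

(** * Calculus on the open unit interval and heights of tangent lines *)

(** The derivative is a parameter rather than [Derive f], so that explicit formulas such as [dPsi],
    or reflected and negated derivatives, can take its place. *)
Definition derivable_on_unit (f f' : R -> R) : Prop :=
  forall x, 0 < x < 1 -> is_derive f x (f' x).

Lemma MVT_unit (f f' : R -> R) (a b : R) :
  derivable_on_unit f f' -> 0 < a -> a < b -> b < 1 ->
  exists c, a < c < b /\ f b - f a = f' c * (b - a).
Proof.
intros Hf Ha Hab Hb.
destruct (MVT_cor2 f f' a b Hab) as [c [E Hc]].
- intros c Hc; apply is_derive_Reals, Hf; lra.
- now exists c.
Qed.

Lemma nonincreasing_of_deriv_nonpos (f f' : R -> R) (a b : R) :
  derivable_on_unit f f' -> 0 < a -> a <= b -> b < 1 ->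
  (forall x, a < x < b -> f' x <= 0) -> f b <= f a.
Proof.
intros Hf Ha Hab Hb Hneg.
destruct (Req_dec a b) as [->|Hne]; [lra|].
destruct (MVT_unit f f' a b Hf Ha ltac:(lra) Hb) as [c [Hc E]].
specialize (Hneg c Hc); nra.
Qed.

Lemma decreasing_of_deriv_neg (f f' : R -> R) (a b : R) :
  derivable_on_unit f f' -> 0 < a -> a < b -> b < 1 ->
  (forall x, a < x < b -> f' x < 0) -> f b < f a.
Proof.
intros Hf Ha Hab Hb Hneg.
destruct (MVT_unit f f' a b Hf Ha Hab Hb) as [c [Hc E]].
specialize (Hneg c Hc); nra.
Qed.

Lemma C2_derivable (g : R -> R) :
  C2_on_unit g ->
  derivable_on_unit g (Derive g) /\
  derivable_on_unit (Derive g) (Derive_n g 2).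
Proof.
intros HC; split; intros x Hx; apply Derive_correct, (HC x Hx).
Qed.

(** A positive value at [x] would persist nearby by continuity; the chord slope right of [x] would
    then exceed the one left of [x], against midpoint concavity. *)
Lemma concave_Derive2_nonpos (g : R -> R) (x : R) :
  C2_on_unit g -> concave_on_unit g -> 0 < x < 1 -> Derive_n g 2 x <= 0.
Proof.
intros HC Hconc Hx.
destruct (C2_derivable g HC) as [D1 D2].
destruct (Rle_or_lt (Derive_n g 2 x) 0) as [|Hpos]; [easy|exfalso].
destruct (HC x Hx) as [_ [_ Hcont]].
destruct (Hcont (fun y => 0 < y)) as [r Hr].
{ apply (open_gt 0); exact Hpos. }
pose proof (cond_pos r) as Hr0.
assert (Hloc : forall y, Rabs (y - x) < r -> 0 < Derive_n g 2 y).
{ intros y Hy; apply Hr; exact Hy. }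
set (h := Rmin r (Rmin x (1 - x)) / 2).
assert (Hh : 0 < h /\ h < r /\ h < x /\ h < 1 - x).
{ unfold h; unfold Rmin; repeat destruct Rle_dec; lra. }
destruct (MVT_unit g (Derive g) x (x + h) D1) as [u [Hu Eu]]; try lra.
destruct (MVT_unit g (Derive g) (x - h) x D1) as [v [Hv Ev]]; try lra.
destruct (MVT_unit _ _ v u D2) as [w [Hw Ew]]; try lra.
assert (0 < Derive_n g 2 w) by (apply Hloc, Rabs_def1; lra).
pose proof (Hconc (x - h) (x + h) (/ 2)
  ltac:(lra) ltac:(lra) ltac:(lra)) as Hmid.
replace (/ 2 * (x - h) + (1 - / 2) * (x + h)) with x in Hmid by field.
assert (0 < Derive g u - Derive g v) by (rewrite Ew; nra).
nra.
Qed.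

(* Moving the point of tangency [p] away from [m], the height at [m] of the
   tangent line has derivative [f'' p * (m - p)], hence increases. *)
Lemma tangent_gap (f f' f'' : R -> R) (m q : R) :
  derivable_on_unit f f' -> derivable_on_unit f' f'' ->
  0 < m < 1 -> 0 < q <= m ->
  (forall x, 0 < x < 1 -> f'' x <= 0) ->
  (forall x, 0 < x < q -> f'' x < 0) ->
  exists c, 0 < c /\
    forall p, 0 < p <= q / 2 -> f m + c <= f p + f' p * (m - p).
Proof.
intros D1 D2 Hm Hq Hle Hlt.
set (phi := fun p => f p + f' p * (m - p)).
assert (Dphi : derivable_on_unit phi (fun p => f'' p * (m - p))).
{ intros x Hx; unfold phi.
  replace (f'' x * (m - x)) with
    (plus (f' x) (plus (mult (f'' x) (m - x)) (mult (f' x) (0 - 1))))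
    by (unfold plus, mult; simpl; ring).
  apply @is_derive_plus; [now apply D1|].
  apply @is_derive_mult; [now apply D2| |intros; apply Rmult_comm].
  apply @is_derive_minus; [apply @is_derive_const|apply @is_derive_id]. }
assert (Hm' : phi m = f m) by (unfold phi; ring).
(* Strict decrease is available only up to [q]; from [q] to [m] weak decrease suffices. The gap is
   thus already won between [q / 2] and [q]. *)
exists (phi (q / 2) - f m); split.
- assert (phi q < phi (q / 2)).
  { apply (decreasing_of_deriv_neg _ _ _ _ Dphi); try lra.
    intros x Hx; specialize (Hlt x ltac:(lra)); nra. }
  assert (phi m <= phi q); [|lra].
  apply (nonincreasing_of_deriv_nonpos _ _ _ _ Dphi); try lra.
  intros x Hx; specialize (Hle x ltac:(lra)); nra.
- intros p Hp; fold (phi p).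
  assert (phi (q / 2) <= phi p); [|lra].
  apply (nonincreasing_of_deriv_nonpos _ _ _ _ Dphi); try lra.
  intros x Hx; specialize (Hle x ltac:(lra)); nra.
Qed.

Lemma derivable_on_unit_reflect (f f' : R -> R) :
  derivable_on_unit f f' ->
  derivable_on_unit (fun x => f (1 - x)) (fun x => - f' (1 - x)).
Proof.
intros D x Hx.
replace (- f' (1 - x)) with (scal (0 - 1) (f' (1 - x)))
  by (unfold scal; simpl; unfold mult; simpl; ring).
apply @is_derive_comp; [apply D; lra|].
apply @is_derive_minus; [apply @is_derive_const|apply @is_derive_id].
Qed.

Lemma derivable_on_unit_opp (f f' : R -> R) :
  derivable_on_unit f f' ->
  derivable_on_unit (fun x => - f x) (fun x => - f' x).
Proof. intros D x Hx; apply @is_derive_opp; now apply D. Qed.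

(** * The function Psi, its derivatives and their bounds *)

Definition dPsi (p : R) : R := - 2 * ln (p / (1 - p)) + / p - / (1 - p).

(** The three terms of the second derivative collapse because 2p(1-p) + p^2 + (1-p)^2 = 1. *)
Definition ddPsi (p : R) : R := - / (p ^ 2 * (1 - p) ^ 2).

Lemma Psi_derivable :
  derivable_on_unit Psi dPsi /\ derivable_on_unit dPsi ddPsi.
Proof.
assert (Hr : forall x, 0 < x < 1 -> 0 < x * / (1 - x)).
{ intros x Hx; apply Rmult_lt_0_compat; [lra|apply Rinv_0_lt_compat; lra]. }
split; intros x Hx; specialize (Hr x Hx).
- unfold Psi, dPsi; auto_derive; [split; [lra|split; [exact Hr|easy]]|].
  unfold Rdiv, Rminus; field; repeat split; lra.
- unfold dPsi, ddPsi; auto_derive; [repeat split; try easy; lra|].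
  field; repeat split; lra.
Qed.

Lemma ln_ratio (p : R) : 0 < p < 1 -> ln (p / (1 - p)) = ln p - ln (1 - p).
Proof. intros Hp; apply ln_div; lra. Qed.

Lemma Psi_nonpos (p : R) : 0 < p < 1 -> Psi p <= 0.
Proof.
intros Hp; unfold Psi; rewrite ln_ratio by easy.
destruct (Rle_or_lt p (1 / 2)).
- pose proof (ln_le p (1 - p) ltac:(lra) ltac:(lra)); nra.
- pose proof (ln_le (1 - p) p ltac:(lra) ltac:(lra)); nra.
Qed.

Lemma Psi_half : Psi (1 / 2) = 0.
Proof. unfold Psi; field_simplify; lra. Qed.

Lemma dPsi_reflect (p : R) : 0 < p < 1 -> dPsi (1 - p) = - dPsi p.
Proof.
intros Hp; unfold dPsi.
rewrite !ln_ratio by lra; replace (1 - (1 - p)) with p by ring; ring.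
Qed.

(** Only the order 1/p matters: ln(1/p) <= 1/p bounds the logarithm, the terms in 1-p have a
    favourable sign, and 1/2 - p <= 1/2. *)
Lemma dPsi_bound (p : R) :
  0 < p <= 1 / 2 -> dPsi p * (1 / 2 - p) <= 3 / 2 * / p.
Proof.
intros Hp.
assert (Hi : 0 < / p) by (apply Rinv_0_lt_compat; lra).
assert (Hln : - ln p <= / p).
{ rewrite <- ln_Rinv by lra.
  pose proof (exp_ineq1_le (ln (/ p))) as E.
  rewrite exp_ln in E by easy; lra. }
assert (dPsi p <= 3 * / p).
{ unfold dPsi; rewrite ln_ratio by lra.
  assert (ln (1 - p) <= 0) by (rewrite <- ln_1; apply ln_le; lra).
  assert (0 < / (1 - p)) by (apply Rinv_0_lt_compat; lra).
  lra. }
nra.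
Qed.

(** * The function H and its bitangent line *)

Lemma Hfun_derivable (g : R -> R) (K : R) :
  C2_on_unit g ->
  derivable_on_unit (Hfun g K) (fun p => Derive g p - 2 * / K * dPsi p) /\
  derivable_on_unit (fun p => Derive g p - 2 * / K * dPsi p)
    (fun p => Derive_n g 2 p - 2 * / K * ddPsi p).
Proof.
intros HC.
destruct (C2_derivable g HC) as [D1 D2], Psi_derivable as [P1 P2].
split; intros x Hx; unfold Hfun; apply @is_derive_minus.
- now apply D1.
- apply is_derive_scal; now apply P1.
- now apply D2.
- apply is_derive_scal; now apply P2.
Qed.

(** Translates membership in the sublevel interval into the sign of H''. *)
Lemma Hfun_second_derivative (g : R -> R) (K p : R) :
  0 < p < 1 ->
  Derive_n g 2 p - 2 * / K * ddPsi p =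
  2 * (genA g p + / K) * / (p ^ 2 * (1 - p) ^ 2).
Proof.
(* With [/ K] abstracted, [field] does not ask for [K <> 0]. *)
intros Hp; unfold genA, ddPsi; generalize (/ K); intros k.
field; lra.
Qed.

(** Convexity on the outer pieces puts the line below [f] at [lo] and [hi]. If [f] dipped under it
    at [x], the chord slope before [x] would be less than [s] and the one after [x] greater, against
    concavity in between. *)
Lemma bitangent_below (f f' f'' : R -> R) (A B lo hi x : R) :
  derivable_on_unit f f' -> derivable_on_unit f' f'' ->
  0 < A <= lo -> hi <= B < 1 -> lo < x < hi ->
  (forall y, 0 < y <= lo -> 0 <= f'' y) ->
  (forall y, hi <= y < 1 -> 0 <= f'' y) ->
  (forall y, lo < y < hi -> f'' y < 0) ->
  f B - f A = f' A * (B - A) -> f' A = f' B ->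
  f A + f' A * (x - A) <= f x.
Proof.
intros D1 D2 HA HB Hx Clo Chi Cmid Ec Es.
destruct (Rle_or_lt (f A + f' A * (x - A)) (f x)) as [|Hlt]; [easy|exfalso].
set (s := f' A) in *.
assert (Hlo : f A + s * (lo - A) <= f lo).
{ destruct (Req_dec A lo) as [->|Hne]; [lra|].
  destruct (MVT_unit f f' A lo D1) as [u [Hu Eu]]; try lra.
  destruct (MVT_unit f' f'' A u D2) as [v [Hv Ev]]; try lra.
  pose proof (Clo v ltac:(lra)); fold s in Ev.
  assert (s <= f' u) by nra; nra. }
assert (Hhi : f A + s * (hi - A) <= f hi).
{ destruct (Req_dec hi B) as [->|Hne]; [lra|].
  destruct (MVT_unit f f' hi B D1) as [u [Hu Eu]]; try lra.
  destruct (MVT_unit f' f'' u B D2) as [v [Hv Ev]]; try lra.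
  pose proof (Chi v ltac:(lra)).
  assert (f' u <= s) by nra; nra. }
destruct (MVT_unit f f' lo x D1) as [u [Hu Eu]]; try lra.
destruct (MVT_unit f f' x hi D1) as [v [Hv Ev]]; try lra.
destruct (MVT_unit f' f'' u v D2) as [w [Hw Ew]]; try lra.
pose proof (Cmid w ltac:(lra)).
assert (f' u < s) by nra.
assert (s < f' v) by nra.
nra.
Qed.

(** * Strict concavity of g near the ends and its tangent gap *)

Lemma genA_nonpos (g : R -> R) (p : R) : G1 g -> 0 < p < 1 -> genA g p <= 0.
Proof.
intros [HC [Hconc _]] Hp.
pose proof (concave_Derive2_nonpos g p HC Hconc Hp) as Hn.
assert (0 < / 2 * p ^ 2 * (1 - p) ^ 2).
{ repeat apply Rmult_lt_0_compat; try apply pow_lt; lra. }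
unfold genA; nra.
Qed.

Lemma genA_neg_Derive2_neg (g : R -> R) (p : R) :
  0 < p < 1 -> genA g p < 0 -> Derive_n g 2 p < 0.
Proof.
intros Hp Hn; unfold genA in Hn.
assert (0 < / 2 * p ^ 2 * (1 - p) ^ 2).
{ repeat apply Rmult_lt_0_compat; try apply pow_lt; lra. }
nra.
Qed.

(* The minimum point [p0] of [genA g] is excluded, as at that point strictness
   would need the continuity of [genA g]. *)
Lemma genA_neg_near_ends (g : R -> R) :
  G1 g -> G2 g ->
  exists q, 0 < q <= 1 / 2 /\
    forall p, (0 < p < q \/ 1 - q < p < 1) -> genA g p < 0.
Proof.
intros H1 [p0 [Hp0 [Hdec Hinc]]].
exists (Rmin (1 / 2) (Rmin p0 (1 - p0))).
pose proof (Rmin_l (1 / 2) (Rmin p0 (1 - p0))).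
pose proof (Rmin_r (1 / 2) (Rmin p0 (1 - p0))).
pose proof (Rmin_l p0 (1 - p0)); pose proof (Rmin_r p0 (1 - p0)).
split; [split; [repeat apply Rmin_pos|]; lra|].
intros p [Hp|Hp].
(* Strictness comes from comparison with a point nearer the end, where [genA g] is at most 0. *)
- pose proof (Hdec (p / 2) p ltac:(lra) ltac:(lra) ltac:(lra)).
  pose proof (genA_nonpos g (p / 2) H1 ltac:(lra)); lra.
- pose proof (Hinc p ((1 + p) / 2) ltac:(lra) ltac:(lra) ltac:(lra)).
  pose proof (genA_nonpos g ((1 + p) / 2) H1 ltac:(lra)); lra.
Qed.

(** [tangent_gap] covers the end 0; the end 1 follows by applying it to the reflection of [g], which
    fixes the point 1/2. *)
Lemma concave_tangent_gap (g : R -> R) (q : R) :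
  G1 g -> 0 < q <= 1 / 2 ->
  (forall p, (0 < p < q \/ 1 - q < p < 1) -> genA g p < 0) ->
  exists c, 0 < c /\
    forall p, (0 < p <= q / 2 \/ 1 - q / 2 <= p < 1) ->
      g (1 / 2) + c <= g p + Derive g p * (1 / 2 - p).
Proof.
intros [HC [Hconc _]] Hq Hneg.
destruct (C2_derivable g HC) as [D1 D2].
destruct (tangent_gap g (Derive g) (Derive_n g 2) (1 / 2) q D1 D2)
  as [c1 [Hc1 G1']]; try lra.
{ intros x Hx; now apply concave_Derive2_nonpos. }
{ intros x Hx; apply genA_neg_Derive2_neg; [lra|apply Hneg; lra]. }
destruct (tangent_gap (fun x => g (1 - x)) (fun x => - Derive g (1 - x))
  (fun x => - - Derive_n g 2 (1 - x)) (1 / 2) q) as [c2 [Hc2 G2']]; try lra.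
{ now apply derivable_on_unit_reflect. }
{ now apply derivable_on_unit_opp, derivable_on_unit_reflect. }
{ intros x Hx.
  pose proof (concave_Derive2_nonpos g (1 - x) HC Hconc ltac:(lra)); lra. }
{ intros x Hx.
  pose proof (genA_neg_Derive2_neg g (1 - x) ltac:(lra)
    (Hneg (1 - x) ltac:(lra))); lra. }
exists (Rmin c1 c2).
pose proof (Rmin_l c1 c2); pose proof (Rmin_r c1 c2).
split; [now apply Rmin_pos|].
intros p [Hp|Hp].
- specialize (G1' p Hp); lra.
- specialize (G2' (1 - p) ltac:(lra)); simpl in G2'.
  replace (1 - (1 - p)) with p in G2' by ring.
  replace (1 - 1 / 2) with (1 / 2) in G2' by field.
  lra.
Qed.

(** * Estimates at the boundary pair *)

Lemma tangent_height_dPsi (g : R -> R) (K c p : R) :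
  C2_on_unit g -> 0 < K -> 0 < p < 1 ->
  g (1 / 2) + c <= g p + Derive g p * (1 / 2 - p) ->
  Hfun g K p + Derive (Hfun g K) p * (1 / 2 - p) <= Hfun g K (1 / 2) ->
  c * K <= 2 * (dPsi p * (1 / 2 - p)).
Proof.
intros HC HK Hp Hgap Htan.
destruct (Hfun_derivable g K HC) as [DH _].
rewrite (is_derive_unique _ _ _ (DH p Hp)) in Htan.
unfold Hfun in Htan; rewrite Psi_half in Htan.
pose proof (Psi_nonpos p Hp).
assert (Hk : 0 < / K) by now apply Rinv_0_lt_compat.
assert (Hc : c <= / K * (2 * (dPsi p * (1 / 2 - p)))) by nra.
apply (Rmult_le_compat_l K) in Hc; [|lra].
rewrite <- Rmult_assoc, Rinv_r in Hc; lra.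
Qed.

(** The tangents at [A] and [B] are one line, so [bitangent_below] serves both; its convexity
    hypotheses come from the sign of H''. *)
Lemma boundary_pair_tangent (g : R -> R) (K A B x : R) :
  C2_on_unit g -> is_boundary_pair g K A B ->
  0 < x < 1 -> genA g x < - / K ->
  A < x < B /\
  Hfun g K A + Derive (Hfun g K) A * (x - A) <= Hfun g K x /\
  Hfun g K B + Derive (Hfun g K) B * (x - B) <= Hfun g K x.
Proof.
intros HC [HA [HB [[lo [hi [[Hlo [Hlh [Hhi Hsub]]] [HAl HBh]]]] [Ec Es]]]]
  Hx HAx.
apply Hsub in HAx; [|easy].
destruct (Hfun_derivable g K HC) as [D1 D2].
assert (Hw : forall y, 0 < y < 1 -> 0 < / (y ^ 2 * (1 - y) ^ 2)).
{ intros y Hy; apply Rinv_0_lt_compat, Rmult_lt_0_compat; apply pow_lt; lra. }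
assert (Hout : forall y, 0 < y < 1 -> ~ lo < y < hi ->
  0 <= Derive_n g 2 y - 2 * / K * ddPsi y).
{ intros y Hy Hn; rewrite Hfun_second_derivative by easy.
  destruct (Rlt_or_le (genA g y) (- / K)) as [Hl|Hl].
  - now apply Hsub in Hl.
  - specialize (Hw y Hy); apply Rmult_le_pos; lra. }
assert (Htan : Hfun g K A + Derive (Hfun g K) A * (x - A) <= Hfun g K x).
{ rewrite (is_derive_unique _ _ _ (D1 A HA)) in *.
  rewrite (is_derive_unique _ _ _ (D1 B HB)) in Es.
  apply (bitangent_below _ _ _ A B lo hi x D1 D2); try easy; try lra.
  - intros y Hy; apply Hout; lra.
  - intros y Hy; apply Hout; lra.
  - intros y Hy; rewrite Hfun_second_derivative by lra.
    assert (genA g y < - / K) by (apply Hsub; lra).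
    specialize (Hw y ltac:(lra)); nra. }
split; [lra|split; [easy|]].
rewrite <- Es.
replace (Derive (Hfun g K) A * (x - B)) with
  (Derive (Hfun g K) A * (x - A) - Derive (Hfun g K) A * (B - A)) by ring.
lra.
Qed.

Theorem proposition4p3 (g : R -> R) (beta : R)
    (hG1 : G1 g) (hG2 : G2 g)
    (hbeta : is_max_on_unit (fun p => Rabs (genA g p)) beta)
    (eps : R) (heps : 0 < eps) :
  exists K0 : R, / beta < K0 /\
  exists C : R, 0 < C /\
    forall K : R, K0 <= K ->
    forall A B : R, is_boundary_pair g K A B ->
      A <= 1 / (1 + C * Rpower K (1 - eps)) /\
      B >= C * Rpower K (1 - eps) / (1 + C * Rpower K (1 - eps)).
Proof.
destruct (genA_neg_near_ends g hG1 hG2) as [q [Hq Hneg]].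
destruct (concave_tangent_gap g q hG1 Hq Hneg) as [c [Hc Hgap]].
pose proof (Hneg (q / 2) ltac:(lra)) as Hn1.
pose proof (Hneg (1 - q / 2) ltac:(lra)) as Hn2.
(* Beyond these thresholds [q / 2] and [1 - q / 2] lie in the sublevel interval, which forces [A]
   and [B] into the range of [Hgap]. *)
set (K1 := / - genA g (q / 2)); set (K2 := / - genA g (1 - q / 2)).
assert (HK1 : 0 < K1) by (apply Rinv_0_lt_compat; lra).
assert (HK2 : 0 < K2) by (apply Rinv_0_lt_compat; lra).
assert (H6c : 0 < 6 / c) by (apply Rdiv_lt_0_compat; lra).
(* [Rabs] spares a proof that [beta] is positive; [6 / c] gives 6 <= cK, and the final 1 gives K >=
   1. *)
exists (Rabs (/ beta) + K1 + K2 + 6 / c + 1).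
split; [pose proof (Rle_abs (/ beta)); lra|].
(* For p = A or p = 1 - B the estimates yield 1/p >= cK/3. One half of this, cK/6, absorbs the
   summand 1; the other half provides [C]. *)
exists (c / 6); split; [lra|].
intros K HK A B HAB.
pose proof (Rabs_pos (/ beta)).
assert (HK0 : 0 < K) by lra.
assert (HcK : 6 <= c * K).
{ replace 6 with (c * (6 / c)) by (field; lra).
  apply Rmult_le_compat_l; lra. }
assert (Hs1 : genA g (q / 2) < - / K).
{ assert (/ K < / K1) by (apply Rinv_lt_contravar; [nra|lra]).
  unfold K1 in *; rewrite Rinv_inv in *; lra. }
assert (Hs2 : genA g (1 - q / 2) < - / K).
{ assert (/ K < / K2) by (apply Rinv_lt_contravar; [nra|lra]).
  unfold K2 in *; rewrite Rinv_inv in *; lra. }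
assert (HC : C2_on_unit g) by apply hG1.
assert (HA01 : 0 < A < 1) by apply HAB.
assert (HB01 : 0 < B < 1) by apply HAB.
destruct (boundary_pair_tangent g K A B (q / 2) HC HAB) as [HA _]; try lra.
destruct (boundary_pair_tangent g K A B (1 - q / 2) HC HAB) as [HB _]; try lra.
(* [Hneg] never reaches 1/2; instead the sublevel set is an interval containing points on both
   sides. *)
assert (Hhalf : genA g (1 / 2) < - / K).
{ destruct HAB as [_ [_ [[lo [hi [[_ [_ [_ Hsub]]] _]]] _]]].
  apply Hsub in Hs1; [|lra]; apply Hsub in Hs2; [|lra]; apply Hsub; lra. }
destruct (boundary_pair_tangent g K A B (1 / 2) HC HAB) as [_ [TA TB]]; try lra.
pose proof (tangent_height_dPsi g K c A HC HK0 HA01 (Hgap A ltac:(lra)) TA) as EA.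
pose proof (tangent_height_dPsi g K c B HC HK0 HB01 (Hgap B ltac:(lra)) TB) as EB.
pose proof (dPsi_bound A ltac:(lra)) as FA.
(* The product of [dPsi p] and 1/2 - p is invariant under p -> 1 - p, so the bound at 1 - B applies
   to [EB]. *)
pose proof (dPsi_bound (1 - B) ltac:(lra)) as FB.
rewrite dPsi_reflect in FB by easy.
(* Only here does [eps] enter: the estimates are linear in K, and K >= 1. *)
assert (Hpow : Rpower K (1 - eps) <= K).
{ rewrite <- (Rpower_1 K) at 2 by easy; apply Rle_Rpower; lra. }
assert (Hpow0 : 0 < Rpower K (1 - eps)) by apply exp_pos.
set (P := Rpower K (1 - eps)) in *.
assert (Hend : forall p, 0 < p -> c * K <= 3 * / p -> p <= 1 / (1 + c / 6 * P)).
{ intros p Hp Hb.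
  assert (0 < c / 6 * P) by (apply Rmult_lt_0_compat; lra).
  assert (1 + c / 6 * P <= / p) by nra.
  unfold Rdiv at 1; rewrite Rmult_1_l, <- (Rinv_inv p).
  apply Rinv_le_contravar; lra. }
split.
- apply Hend; lra.
- pose proof (Hend (1 - B) ltac:(lra) ltac:(lra)) as HB'.
  assert (0 < c / 6 * P) by (apply Rmult_lt_0_compat; lra).
  replace (c / 6 * P / (1 + c / 6 * P)) with (1 - 1 / (1 + c / 6 * P))
    by (field; lra).
  lra.
Qed.
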